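(* Fix $\sigma,\tau>0$ and let $k=n\sigma(1-e^{-1/\sigma})$ and $l=n\tau(1-e^{-1/\tau})$. Then, as $n\to\infty$, $$m_{kl}(n)\sim\frac{n^{2n}}{n!}\,e^{n w(\sigma)}v(\sigma)\,e^{n w(\tau)}v(\tau)\,e^{-\frac{1}{2\sigma\tau}},$$ where $$w(x)=x(1-e^{-1/x})\log(1-e^{-1/x})+\log x-e^{-1/x},\qquad v(x)=\sqrt{\frac{x(1-e^{-1/x})}{x(1-e^{-1/x})-e^{-1/x}}}.$$
   Context: An incidence matrix is a zero-one matrix with no zero rows and no zero columns. For integers $k,l,n\ge0$, $m_{kl}(n)$ is the number of $k\times l$ incidence matrices with exactly $n$ ones. $a_n\sim b_n$ means $a_n/b_n\to1$. *)

(* Defs.v *)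
From HB Require Import structures.
From mathcomp Require Import all_boot all_order all_algebra.
From mathcomp Require Import all_classical all_reals all_analysis.

Set Implicit Arguments.
Unset Strict Implicit.
Unset Printing Implicit Defensive.

Import Order.TTheory GRing.Theory Num.Theory.
Import numFieldNormedType.Exports.

Local Open Scope ring_scope.

(* Zero-one matrices are represented by boolean matrices. *)
Definition incidence_mx (k l : nat) (M : 'M[bool]_(k, l)) : bool :=
  [forall i : 'I_k, exists j : 'I_l, M i j] &&
  [forall j : 'I_l, exists i : 'I_k, M i j].

Definition ones (k l : nat) (M : 'M[bool]_(k, l)) : nat :=
  #|[pred p : 'I_k * 'I_l | M p.1 p.2]|.

Definition num_incidence (k l n : nat) : nat :=
  #|[pred M : 'M[bool]_(k, l) | incidence_mx M && (ones M == n)]|.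

Section Constants.
Variable R : realType.
Implicit Types x : R.

Definition w x : R :=
  x * (1 - expR (- (1 / x))) * ln (1 - expR (- (1 / x)))
  + ln x - expR (- (1 / x)).

Definition v x : R :=
  Num.sqrt (x * (1 - expR (- (1 / x))) /
            (x * (1 - expR (- (1 / x))) - expR (- (1 / x)))).

End Constants.

(* Main.v *)
(** Write [r = 1 / sigma] and let [surj(m, k)] be the number of surjections from
    an [m]-set onto a [k]-set.  Inclusion-exclusion over the empty rows and
    columns, followed by the expansion of the falling factorial [(ab)^_n] in
    powers of [ab], gives
      [n! m_kl(n) = \sum_i (-1)^i c(n, n - i) surj(n - i, k) surj(n - i, l)]
    with [c] the unsigned Stirling numbers of the first kind.

    Up to the factor [r^m / m! / (e^r - 1)^k], the number [surj(m, k)] is the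
    probability that [k] independent Poisson([r]) variables conditioned to be
    positive sum up to [m].  The prescribed [k] makes [n] the mean of that sum,
    so the local limit theorem gives
    [surj(n - i, k) ~ (r / n)^i n^n e^(n w(sigma)) v(sigma)] for each fixed [i];
    the factor [n!] is handled by the local limit theorem for the Poisson law.

    Since [c(n, n - i) ~ n^(2i) / (2^i i!)], the [i]-th term of the sum, divided
    by the [0]-th one, tends to [(- 1 / (2 sigma tau))^i / i!].  The inequality
    [k^i surj(n - i, k) <= surj(n, k)] dominates the terms by those of an
    exponential series, so the sum of the limits is the limit of the sums. *)

Require Import Defs.
From HB Require Import structures.
From mathcomp Require Import all_boot all_order all_algebra.
From mathcomp Require Import all_classical all_reals all_analysis.
From mathcomp Require Import measurable_realfun complex.
From mathcomp Require Import zify ring lra.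

Set Implicit Arguments.
Unset Strict Implicit.
Unset Printing Implicit Defensive.

Import Order.TTheory GRing.Theory Num.Theory.
Import numFieldNormedType.Exports.
Import ComplexField.Normc.

Local Open Scope ring_scope.
Local Notation Re := complex.Re.
Local Notation Im := complex.Im.

(** * Exact enumeration *)

Lemma natr_card (R : pzSemiRingType) (I : finType) (P : pred I) :
  #|P|%:R = \sum_i (P i)%:R :> R.
Proof.
rewrite -sum1_card natr_sum big_mkcond; apply: eq_bigr => i _.
by rewrite unfold_in; case: (P i).
Qed.

Section InclusionExclusion.
Variables (R : comNzRingType) (I : finType).
Implicit Types (P : pred I) (f g : I -> R) (x : R).

Lemma natr_forall_in (A : {set I}) P :
  [forall i in A, P i]%:R = \prod_(i in A) (P i)%:R :> R.
Proof.
case: (boolP [forall i in A, P i]) => [/'forall_implyP PA|].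
  by rewrite big1 // => i /PA ->.
rewrite negb_forall_in => /exists_inP[i iA /negbTE Pi].
by rewrite (bigD1 i) //= Pi mul0r.
Qed.

Lemma prodrB_subsets f g : \prod_i (f i - g i) =
  \sum_(A : {set I}) (-1) ^+ #|~: A| *
    (\prod_(i in A) f i * \prod_(i in ~: A) g i).
Proof.
rewrite bigA_distr; apply: eq_bigr => A _.
rewrite mulrCA -prodrN.
rewrite (bigID [in A]) /=; congr (_ * _).
  by apply: eq_bigr => i ->.
by apply: eq_big => [i|i /negbTE ->]; rewrite ?inE.
Qed.

Lemma exprB1_subsets x :
  (x - 1) ^+ #|I| = \sum_(A : {set I}) (-1) ^+ #|~: A| * x ^+ #|A|.
Proof.
rewrite -prodr_const prodrB_subsets; apply: eq_bigr => A _.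
by rewrite prodr_const big1 // mulr1.
Qed.

Lemma forall_inclusion_exclusion P : [forall i, P i]%:R =
  \sum_(A : {set I}) (-1) ^+ #|~: A| * [forall i in ~: A, ~~ P i]%:R :> R.
Proof.
transitivity (\prod_i (1 - (~~ P i)%:R) : R).
  rewrite (_ : [forall i, P i] = [forall i in [set: I], P i]); last first.
    by apply: eq_forallb => i; rewrite inE.
  rewrite natr_forall_in; apply: eq_big => [i|i _]; first by rewrite inE.
  by case: (P i); rewrite (subr0, subrr).
rewrite prodrB_subsets; apply: eq_bigr => A _.
by rewrite natr_forall_in big1 // mul1r.
Qed.

End InclusionExclusion.

Definition num_surj (m k : nat) : nat :=
  #|[pred f : {ffun 'I_m -> 'I_k} | [forall y, y \in codom f]]|.

Lemma num_surj_subsets (R : comNzRingType) m k : (num_surj m k)%:R =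
  \sum_(A : {set 'I_k}) (-1) ^+ #|~: A| * #|A|%:R ^+ m :> R.
Proof.
rewrite natr_card; under eq_bigr do rewrite /= forall_inclusion_exclusion.
rewrite exchange_big; apply: eq_bigr => A _.
rewrite -mulr_sumr -natrX -[in RHS](card_ord m) -card_ffun_on natr_card.
congr (_ * _); apply: eq_bigr => f _; congr (nat_of_bool _)%:R.
apply/'forall_implyP/ffun_onP => [fA i|fA y].
  by apply: contraT => fi; have := fA (f i); rewrite inE fi codom_f => /(_ isT).
by rewrite inE; apply: contra => /codomP[i ->].
Qed.

Lemma expn_num_surj_le i m k : (k ^ i * num_surj m k <= num_surj (i + m) k)%N.
Proof.
pose glue (p : {ffun 'I_i -> 'I_k} * {ffun 'I_m -> 'I_k}) : {ffun 'I_(i + m) -> 'I_k} :=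
  [ffun j => match fintype.split j with inl a => p.1 a | inr b => p.2 b end].
have glue_inj : injective glue.
  move=> [g f] [g' f'] /ffunP e; congr pair; apply/ffunP => a.
    by have := e (lshift m a); rewrite !ffunE (unsplitK (inl a)).
  by have := e (rshift i a); rewrite !ffunE (unsplitK (inr a)).
set surj := [pred f : {ffun 'I_m -> 'I_k} | [forall y, y \in codom f]].
have -> : (k ^ i = #|[pred f : {ffun 'I_i -> 'I_k} | true]|)%N.
  by rewrite card_ffun !card_ord.
rewrite /num_surj -cardX -(fintype.card_image glue_inj).
apply/subset_leq_card/fintype.subsetP => _ /fintype.imageP[[g f] /andP[_ fsurj] ->].
apply/forallP => y; have /codomP[b ->] := forallP fsurj y.
by apply/codomP; exists (rshift i b); rewrite ffunE (unsplitK (inr b)).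
Qed.

Lemma card_mx_ones_within k l n (S : {set 'I_k * 'I_l}) :
  #|[pred M : 'M[bool]_(k, l) |
     ([set p | M p.1 p.2] \subset S) && (ones M == n)]| = 'C(#|S|, n).
Proof.
pose supp (M : 'M[bool]_(k, l)) := [set p | M p.1 p.2].
have supp_bij : bijective supp.
  exists (fun S : {set 'I_k * 'I_l} => \matrix_(i, j) ((i, j) \in S)) => [M|T].
    by apply/matrixP => i j; rewrite mxE inE.
  by apply/setP => -[i j]; rewrite inE mxE.
rewrite -cards_draws -(on_card_preimset (onW_bij _ supp_bij)).
by apply: eq_card => M; rewrite !inE /ones cardsE.
Qed.

Lemma num_incidence_subsets (R : comNzRingType) k l n : (num_incidence k l n)%:R =
  \sum_(A : {set 'I_k}) \sum_(B : {set 'I_l})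
    (-1) ^+ #|~: A| * (-1) ^+ #|~: B| * 'C(#|A| * #|B|, n)%:R :> R.
Proof.
pose within_ones (M : 'M[bool]_(k, l)) A B :=
  ([set p | M p.1 p.2] \subset finset.setX A B) && (ones M == n).
transitivity (\sum_(M : 'M[bool]_(k, l)) \sum_(A : {set 'I_k}) \sum_(B : {set 'I_l})
    (-1) ^+ #|~: A| * (-1) ^+ #|~: B| * (within_ones M A B)%:R : R).
  rewrite natr_card; apply: eq_bigr => M _ /=.
  rewrite -!mulnb !natrM !forall_inclusion_exclusion big_distrlr mulr_suml.
  apply: eq_bigr => A _; rewrite mulr_suml; apply: eq_bigr => B _.
  rewrite /= mulrACA -!mulrA -!natrM !mulnb andbA; do 2 congr (_ * _).
  congr (nat_of_bool (_ && _))%:R.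
  apply/andP/fintype.subsetP => [[/'forall_implyP rowA /'forall_implyP colB] [i j]|MAB].
    rewrite inE finset.in_setX /= => Mij; apply/andP; split; apply: contraT => out.
      have := rowA i; rewrite inE out negb_exists => /(_ isT)/forallP/(_ j).
      by rewrite Mij.
    have := colB j; rewrite inE out negb_exists => /(_ isT)/forallP/(_ i).
    by rewrite Mij.
  split; apply/'forall_implyP => i; rewrite inE; apply: contra => /existsP[j Mij].
    by have := MAB (i, j); rewrite inE finset.in_setX => /(_ Mij)/andP[].
  by have := MAB (j, i); rewrite inE finset.in_setX => /(_ Mij)/andP[].
rewrite exchange_big; apply: eq_bigr => A _.
rewrite exchange_big; apply: eq_bigr => B _.
by rewrite -mulr_sumr -cardsX -card_mx_ones_within natr_card.
Qed.

(* The unsigned Stirling number of the first kind [c(n, n - i)]. *)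
Fixpoint ffact_coef (n i : nat) : nat :=
  match n, i with
  | _, 0 => 1
  | 0, _.+1 => 0
  | n'.+1, i'.+1 => ffact_coef n' i'.+1 + n' * ffact_coef n' i'
  end.

Lemma ffact_coefn0 n : ffact_coef n 0 = 1%N. Proof. by case: n. Qed.

Lemma ffact_coefSS n i :
  ffact_coef n.+1 i.+1 = (ffact_coef n i.+1 + n * ffact_coef n i)%N.
Proof. by []. Qed.

Lemma ffact_coef_small n i : (n <= i)%N -> (0 < i)%N -> ffact_coef n i = 0%N.
Proof.
elim: n i => [|n IH] [|i] //; rewrite ltnS => ni _.
rewrite ffact_coefSS IH ?(leq_trans ni) // add0n.
by case: n IH ni => [|n] IH ni //; rewrite IH ?muln0 // (leq_trans _ ni).
Qed.

Lemma natr_ffact (R : comNzRingType) x n : (x ^_ n)%:R =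
  \sum_(i < n.+1) (-1) ^+ i * (ffact_coef n i)%:R * x%:R ^+ (n - i) :> R.
Proof.
elim: n => [|n IH]; first by rewrite big_ord_recl big_ord0 ffactn0 /= !mulr1 addr0.
have -> : (x ^_ n.+1)%:R = (x ^_ n)%:R * x%:R - n%:R * (x ^_ n)%:R :> R.
  rewrite ffactnSr natrM; case: (leqP n x) => nx; first by rewrite natrB //; ring.
  by rewrite ffact_small // !mul0r mulr0 subrr.
rewrite IH mulr_suml [in LHS]big_ord_recl [in RHS]big_ord_recl !ffact_coefn0 !subn0.
rewrite -addrA; congr (_ + _); first by rewrite exprSr !mulrA.
rewrite mulr_sumr -sumrN [X in _ + X]big_ord_recr [RHS]big_ord_recr /=.
rewrite addrA -big_split /=; congr (_ + _).
  apply: eq_bigr => i _; rewrite /bump /= !add1n subSS.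
  have -> : (n - i = (n - i.+1).+1)%N by rewrite subnSK.
  by rewrite natrD natrM !exprS; ring.
by rewrite (@ffact_coef_small n n.+1) // add0n !subnn !expr0 natrM exprS; ring.
Qed.

Lemma double_factS i : (2 ^ i.+1 * i.+1`! = (2 * i).+2 * (2 ^ i * i`!))%N.
Proof. by rewrite expnS factS; ring. Qed.

Lemma ffact_coef_le_expn n i : (2 ^ i * i`! * ffact_coef n i <= n ^ (2 * i))%N.
Proof.
elim: n i => [|n IH] [|i]; rewrite ?ffact_coefn0 ?expn0 ?muln0 //.
rewrite ffact_coefSS mulnDr {2}double_factS mulnACA.
apply: leq_trans (leq_add (IH i.+1) (leq_mul (leqnn _) (IH i))) _.
have -> : ((2 * i).+2 * n * n ^ (2 * i) = (2 * i).+2 * n ^ (2 * i).+1)%N.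
  by rewrite expnS mulnA.
rewrite (_ : 2 * i.+1 = (2 * i).+2)%N; last by ring.
rewrite -[n.+1]addn1 expnDn big_ord_recl bin0 mul1n subn0 exp1n muln1 leq_add2l.
by rewrite big_ord_recl /= bin1 exp1n muln1 /bump /= subSS subn0 leq_addr.
Qed.

Lemma ffact_le_ffact_coef n i : (n ^_ (2 * i) <= 2 ^ i * i`! * ffact_coef n i)%N.
Proof.
elim: n i => [|n IH] [|i]; rewrite ?ffact_coefn0 //.
rewrite ffact_coefSS mulnDr {2}double_factS mulnACA.
apply: leq_trans (leq_add (IH i.+1) (leq_mul (leqnn _) (IH i))).
rewrite (_ : 2 * i.+1 = (2 * i).+2)%N; last by ring.
rewrite ffactSS (ffactnSr n (2 * i).+1); set F := (n ^_ (2 * i).+1)%N.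
have leF : (F <= n * n ^_ (2 * i))%N.
  by rewrite /F ffactnSr mulnC leq_mul2r leq_subr orbT.
case: (leqP (2 * i).+1 n) => ni; last by rewrite /F ffact_small // muln0.
have -> : (n.+1 * F = F * (n - (2 * i).+1) + (2 * i).+2 * F)%N.
  by rewrite (mulnC F) -mulnDl; congr (_ * _)%N; lia.
by rewrite leq_add2l -mulnA leq_mul2l leF.
Qed.

Lemma fact_num_incidence (R : comNzRingType) k l n :
  n`!%:R * (num_incidence k l n)%:R =
  \sum_(i < n.+1) (-1) ^+ i * (ffact_coef n i)%:R *
    (num_surj (n - i) k)%:R * (num_surj (n - i) l)%:R :> R.
Proof.
rewrite num_incidence_subsets mulr_sumr.
transitivity (\sum_(A : {set 'I_k}) \sum_(B : {set 'I_l}) \sum_(i < n.+1)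
  (-1) ^+ i * (ffact_coef n i)%:R *
  ((-1) ^+ #|~: A| * #|A|%:R ^+ (n - i)) *
  ((-1) ^+ #|~: B| * #|B|%:R ^+ (n - i)) : R).
  apply: eq_bigr => A _; rewrite mulr_sumr; apply: eq_bigr => B _.
  rewrite mulrCA -natrM mulnC bin_ffact natr_ffact mulr_sumr.
  by apply: eq_bigr => i _; rewrite natrM exprMn; ring.
under eq_bigr do rewrite exchange_big.
rewrite exchange_big; apply: eq_bigr => i _.
rewrite !num_surj_subsets -[RHS]mulrA big_distrlr mulr_sumr; apply: eq_bigr => A _.
by rewrite mulr_sumr; apply: eq_bigr => B _; rewrite -!mulrA.
Qed.

Local Open Scope classical_set_scope.
Local Open Scope ring_scope.

(** * Complex-valued functions of a real variable *)

Section ComplexValued.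
Variable R : realType.
Implicit Types (a b t v x y : R) (z w : R[i]) (f g : R -> R[i]).

Lemma normc_ge0 z : 0 <= normc z.
Proof. by case: z => x y; exact: sqrtr_ge0. Qed.

Lemma normc_real x : normc x%:C%C = `|x|.
Proof. by rewrite /= expr0n addr0 sqrtr_sqr. Qed.

Lemma normcX z n : normc (z ^+ n) = normc z ^+ n.
Proof. by elim: n => [|n IH]; rewrite ?expr0 ?exprS ?normcM ?IH // normc1. Qed.

Lemma ler_normc_Re z : `|Re z| <= normc z.
Proof. by case: z => x y /=; rewrite -sqrtr_sqr ler_wsqrtr // lerDl sqr_ge0. Qed.

Lemma normc_exprB_le z w n : normc z <= 1 -> normc w <= 1 ->
  normc (z ^+ n - w ^+ n) <= n%:R * normc (z - w).
Proof.
move=> z1 w1; elim: n => [|n IH]; first by rewrite !expr0 subrr normc0 mul0r.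
have -> : z ^+ n.+1 - w ^+ n.+1 = z * (z ^+ n - w ^+ n) + (z - w) * w ^+ n.
  by rewrite !exprS; ring.
rewrite (le_trans (le_normcD _ _)) // !normcM -nat1r mulrDl mul1r addrC lerD //.
  by rewrite ler_piMr ?normc_ge0 // normcX exprn_ile1 ?normc_ge0.
by rewrite (le_trans _ IH) // ler_piMl ?normc_ge0.
Qed.

Definition ccontinuous f :=
  continuous (fun t => Re (f t)) /\ continuous (fun t => Im (f t)).

Lemma ccontinuous_cst z : ccontinuous (fun=> z).
Proof. by split=> t; exact: cvg_cst. Qed.

Lemma ccontinuousD f g : ccontinuous f -> ccontinuous g ->
  ccontinuous (fun t => f t + g t).
Proof.
move=> [cRf cIf] [cRg cIg]; split => x.
  rewrite (_ : (fun t => _) = (fun t => Re (f t) + Re (g t))).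
    by apply: cvgD; [exact: cRf|exact: cRg].
  by apply/funext => t /=; case: (f t) (g t) => [? ?] [].
rewrite (_ : (fun t => _) = (fun t => Im (f t) + Im (g t))).
  by apply: cvgD; [exact: cIf|exact: cIg].
by apply/funext => t /=; case: (f t) (g t) => [? ?] [].
Qed.

Lemma ccontinuousM f g : ccontinuous f -> ccontinuous g ->
  ccontinuous (fun t => f t * g t).
Proof.
move=> [cRf cIf] [cRg cIg]; split => x.
  rewrite (_ : (fun t => _) = (fun t => Re (f t) * Re (g t) - Im (f t) * Im (g t))).
    by apply: cvgB; apply: cvgM; [exact: cRf|exact: cRg|exact: cIf|exact: cIg].
  by apply/funext => t /=; case: (f t) (g t) => [? ?] [].
rewrite (_ : (fun t => _) = (fun t => Re (f t) * Im (g t) + Im (f t) * Re (g t))).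
  by apply: cvgD; apply: cvgM; [exact: cRf|exact: cIg|exact: cIf|exact: cRg].
by apply/funext => t /=; case: (f t) (g t) => [? ?] [].
Qed.

Lemma ccontinuousX f n : ccontinuous f -> ccontinuous (fun t => f t ^+ n).
Proof.
move=> cf; elim: n => [|n IH]; first exact: ccontinuous_cst.
by under eq_fun do rewrite exprS; exact: ccontinuousM.
Qed.

Lemma continuous_normc f : ccontinuous f -> continuous (fun t => normc (f t)).
Proof.
move=> [cRf cIf] t.
rewrite (_ : (fun t => _) = (fun t => Num.sqrt (Re (f t) ^+ 2 + Im (f t) ^+ 2))).
  apply: continuous_comp; last exact: sqrt_continuous.
  by apply: cvgD; apply: cvgM; (exact: cRf || exact: cIf).
by apply/funext => u; case: (f u).
Qed.

Lemma derivable1_continuous (h : R -> R) t :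
  derivable h t 1 -> {for t, continuous h}.
Proof. by move=> dh; exact/differentiable_continuous/derivable1_diffP. Qed.

Lemma is_derive_continuous (h dh : R -> R) :
  (forall t, is_derive t 1 h (dh t)) -> continuous h.
Proof. by move=> hd t; apply: derivable1_continuous; case: (hd t). Qed.

Lemma MVT_between (h dh : R -> R) a b : (forall t, is_derive t 1 h (dh t)) ->
  exists2 c, Num.min a b <= c <= Num.max a b & h b - h a = dh c * (b - a).
Proof.
move=> hd; have ch := is_derive_continuous hd.
wlog ab : a b / a <= b => [hw|].
  have /orP[/hw //|/hw[c cba e]] := le_total a b.
  exists c; first by rewrite minC maxC.
  by rewrite -[LHS]opprB e -mulrN opprB.
have [c + e] := @MVT_segment _ h dh a b ab (fun t _ => hd t) (continuous_subspaceT ch).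
by rewrite in_itv /= => cab; exists c => //; rewrite (min_idPl ab) (max_idPr ab).
Qed.

Lemma norm_between0 t c : Num.min 0 t <= c <= Num.max 0 t -> `|c| <= `|t|.
Proof.
have [t0|t0] := leP 0 t => /andP[c1 c2]; first by rewrite !ger0_norm.
by rewrite !ler0_norm ?lerN2 // ltW.
Qed.

(* [cexp a b t] is [exp (a e^(it) + ibt)]. *)
Definition expcos a b t : R := expR (a * cos t) * cos (a * sin t + b * t).
Definition expsin a b t : R := expR (a * cos t) * sin (a * sin t + b * t).
Definition cexp a b t : R[i] := (expcos a b t +i* expsin a b t)%C.

Lemma is_derive_expcos a b t :
  is_derive t 1 (expcos a b) (- (a * expsin a (b + 1) t + b * expsin a b t)).
Proof.
rewrite /expcos; apply: is_derive_eq.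
rewrite /expsin ?scaler0 ?add0r /GRing.scale /= mulrDl mul1r addrA.
by rewrite (sinD (a * sin t + b * t)); ring.
Qed.

Lemma is_derive_expsin a b t :
  is_derive t 1 (expsin a b) (a * expcos a (b + 1) t + b * expcos a b t).
Proof.
rewrite /expsin; apply: is_derive_eq.
rewrite /expcos ?scaler0 ?add0r /GRing.scale /= mulrDl mul1r addrA.
by rewrite (cosD (a * sin t + b * t)); ring.
Qed.

Lemma is_derive_expcos_amplitude a b t :
  is_derive a 1 (fun x => expcos x b t) (expcos a (b + 1) t).
Proof.
rewrite /expcos; apply: is_derive_eq.
rewrite /GRing.scale /= mulrDl mul1r addrA.
by rewrite (cosD (a * sin t + b * t)); ring.
Qed.

Lemma continuous_expcos a b : continuous (expcos a b).
Proof. exact: is_derive_continuous (is_derive_expcos a b). Qed.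

Lemma continuous_expsin a b : continuous (expsin a b).
Proof. exact: is_derive_continuous (is_derive_expsin a b). Qed.

Lemma ccontinuous_cexp a b : ccontinuous (cexp a b).
Proof. by split; [exact: continuous_expcos|exact: continuous_expsin]. Qed.

Lemma norm_expcos_le a b t : `|expcos a b t| <= expR `|a|.
Proof.
rewrite normrM ger0_norm ?expR_ge0 // -[leRHS]mulr1.
rewrite ler_pM ?expR_ge0 ?cos_max // ler_expR (le_trans (ler_norm _)) // normrM.
by rewrite ler_piMr ?cos_max.
Qed.

Lemma cexpM a b a' b' t : cexp a b t * cexp a' b' t = cexp (a + a') (b + b') t.
Proof.
rewrite /cexp /expcos /expsin !mulrDl expRD.
rewrite (_ : a * sin t + a' * sin t + _ =
  (a * sin t + b * t) + (a' * sin t + b' * t)); last by ring.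
rewrite (cosD (a * sin t + b * t)) (sinD (a * sin t + b * t)).
by apply/eqP; rewrite eq_complex /=; apply/andP; split; apply/eqP; ring.
Qed.

Lemma cexp00 t : cexp 0 0 t = 1.
Proof. by rewrite /cexp /expcos /expsin !mul0r addr0 expR0 cos0 sin0 mulr1 mulr0. Qed.

Lemma cexp_at0 a b : cexp a b 0 = (expR a)%:C%C.
Proof.
by rewrite /cexp /expcos /expsin cos0 sin0 !mulr0 addr0 cos0 sin0 !mulr1 mulr0.
Qed.

Lemma cexpX a b t n : cexp a b t ^+ n = cexp (n%:R * a) (n%:R * b) t.
Proof.
elim: n => [|n IH]; first by rewrite expr0 !mul0r cexp00.
by rewrite exprS IH cexpM -!nat1r !mulrDl !mul1r.
Qed.

Lemma normc_cexp a b t : normc (cexp a b t) = expR (a * cos t).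
Proof.
rewrite /= /expcos /expsin !exprMn -mulrDr cos2Dsin2 mulr1 sqrtr_sqr.
by rewrite ger0_norm ?expR_ge0.
Qed.

Definition gauss v t := expR (- (v * t ^+ 2 / 2)).

Lemma gauss_ge0 v t : 0 <= gauss v t. Proof. exact: expR_ge0. Qed.

Lemma gauss_le1 v t : 0 <= v -> gauss v t <= 1.
Proof.
move=> v0; rewrite /gauss -[leRHS]expR0 ler_expR oppr_le0.
by rewrite divr_ge0 // mulr_ge0 ?sqr_ge0.
Qed.

Lemma is_derive_gauss v t : is_derive t 1 (gauss v) (- (v * t * gauss v t)).
Proof.
rewrite /gauss; apply: is_derive_eq.
by rewrite ?scaler0 ?add0r /GRing.scale /=; field.
Qed.

Lemma gauss_div_sqrtX v t k : gauss v (t / Num.sqrt k.+1%:R) ^+ k.+1 = gauss v t.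
Proof.
rewrite -expRM_natr exprMn exprVn sqr_sqrtr //; congr expR.
by field; rewrite nat1r pnatr_eq0.
Qed.

End ComplexValued.

#[local] Existing Instance is_derive_expcos.
#[local] Existing Instance is_derive_expsin.
#[local] Existing Instance is_derive_gauss.
#[local] Typeclasses Opaque expcos expsin gauss.

Section SecondOrderTaylor.
Variable R : realType.
Implicit Types (f g : R -> R[i]) (a b v t : R).

Definition littleo_sqr f : Prop :=
  forall e : R, 0 < e -> \forall t \near 0, normc (f t) <= e * t ^+ 2.

Lemma littleo_sqrD f g : littleo_sqr f -> littleo_sqr g ->
  littleo_sqr (fun t => f t + g t).
Proof.
move=> fo go e e0; have e2 : 0 < e / 2 by rewrite divr_gt0.
near=> t; rewrite (le_trans (le_normcD _ _)) // (splitr e) mulrDl lerD //.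
  by near: t; exact: fo.
by near: t; exact: go.
Unshelve. all: by end_near. Qed.

Lemma littleo_sqrZ (z : R[i]) f : littleo_sqr f -> littleo_sqr (fun t => z * f t).
Proof.
move=> fo e e0; have z1 : 0 < normc z + 1 by rewrite ltr_wpDl ?normc_ge0.
near=> t; rewrite normcM.
have ft : normc (f t) <= e / (normc z + 1) * t ^+ 2.
  by near: t; apply: fo; rewrite divr_gt0.
rewrite (le_trans (ler_wpM2l (normc_ge0 z) ft)) // mulrA ler_wpM2r ?sqr_ge0 //.
by rewrite mulrA ler_pdivrMr // mulrC ler_wpM2l ?(ltW e0) // lerDl.
Unshelve. all: by end_near. Qed.

Lemma littleo_sqr_taylor (h h1 h2 : R -> R) :
  (forall t, is_derive t 1 h (h1 t)) -> (forall t, is_derive t 1 h1 (h2 t)) ->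
  {for 0, continuous h2} ->
  littleo_sqr (fun t => (h t - (h 0 + h1 0 * t + h2 0 / 2 * t ^+ 2))%:C%C).
Proof.
move=> dh dh1 ch2.
pose rem t := h t - (h 0 + h1 0 * t + h2 0 / 2 * t ^+ 2).
pose rem1 t := h1 t - (h1 0 + h2 0 * t).
have drem (t : R) : is_derive t 1 rem (rem1 t).
  by rewrite /rem; apply: is_derive_eq; rewrite /rem1 /GRing.scale /=; field.
have drem1 (t : R) : is_derive t 1 rem1 (h2 t - h2 0).
  by rewrite /rem1; apply: is_derive_eq; rewrite /GRing.scale /=; ring.
have rem00 : rem 0 = 0 by rewrite /rem; ring.
have rem10 : rem1 0 = 0 by rewrite /rem1; ring.
move=> e e0; have [d /= d0 h2d] := (cvgrPdist_le _ _).1 ch2 _ e0.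
suff: \forall t \near 0, `|rem t| <= e * t ^+ 2.
  by apply: filterS => t; rewrite -normc_real.
exists d => //= t /=; rewrite sub0r normrN => td.
have [x xt] := MVT_between 0 t drem; have [y yx] := MVT_between 0 x drem1.
rewrite rem00 rem10 !subr0 => -> ->.
have {}xt := norm_between0 xt; have {}yx := norm_between0 yx.
rewrite -real_normK ?num_real // expr2 mulrA !normrM ler_wpM2r // ler_pM //.
by rewrite distrC h2d //= sub0r normrN (le_lt_trans yx) ?(le_lt_trans xt).
Qed.

Lemma littleo_sqr_ReIm f : littleo_sqr (fun t => (Re (f t))%:C%C) ->
  littleo_sqr (fun t => (Im (f t))%:C%C) -> littleo_sqr f.
Proof.
move=> /littleo_sqrD Ro /(@littleo_sqrZ 'i%C)/Ro.
by congr littleo_sqr; apply/funext => t; rewrite -complexE.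
Qed.

Lemma littleo_sqr_cexp a b : littleo_sqr (fun t => cexp a b t -
  (expR a)%:C%C * ((1 - ((a + b) ^+ 2 + a) / 2 * t ^+ 2) +i* ((a + b) * t))%C).
Proof.
have cos0E x : expcos a x 0 = expR a by have := cexp_at0 a x => -[].
have sin0E x : expsin a x 0 = 0 by have := cexp_at0 a x => -[].
pose dcos x t := - (a * expsin a (x + 1) t + x * expsin a x t).
pose dsin x t := a * expcos a (x + 1) t + x * expcos a x t.
have ddcos (t : R) : is_derive t 1 (dcos b) (- (a * dsin (b + 1) t + b * dsin b t)).
  by rewrite /dcos; apply: is_derive_eq; rewrite /dsin /GRing.scale /=; ring.
have ddsin (t : R) : is_derive t 1 (dsin b) (a * dcos (b + 1) t + b * dcos b t).
  by rewrite /dsin; apply: is_derive_eq; rewrite /dcos /GRing.scale /=; ring.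
apply: littleo_sqr_ReIm.
  have cdd : {for 0, continuous (fun t => - (a * dsin (b + 1) t + b * dsin b t))}.
    by apply: derivable1_continuous; rewrite /dsin; exact: ex_derive.
  have := littleo_sqr_taylor (is_derive_expcos a b) ddcos cdd.
  congr littleo_sqr; apply/funext => t; congr (_%:C%C).
  by rewrite /= /dcos /dsin !cos0E !sin0E; field.
have cdd : {for 0, continuous (fun t => a * dcos (b + 1) t + b * dcos b t)}.
  by apply: derivable1_continuous; rewrite /dcos; exact: ex_derive.
have := littleo_sqr_taylor (is_derive_expsin a b) ddsin cdd.
congr littleo_sqr; apply/funext => t; congr (_%:C%C).
by rewrite /= /dcos /dsin !cos0E !sin0E; field.
Qed.

Lemma littleo_sqr_gauss v :
  littleo_sqr (fun t => (gauss v t - (1 - v / 2 * t ^+ 2))%:C%C).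
Proof.
have gauss0 : gauss v 0 = 1 by rewrite /gauss expr0n mulr0 mul0r oppr0 expR0.
pose d1 t := - (v * t * gauss v t).
pose d2 t := ((v * t) ^+ 2 - v) * gauss v t.
have d1E (t : R) : is_derive t 1 d1 (d2 t).
  by rewrite /d1; apply: is_derive_eq; rewrite /d2 /GRing.scale /=; ring.
have cd2 : {for 0, continuous d2}.
  by apply: derivable1_continuous; rewrite /d2; exact: ex_derive.
have := littleo_sqr_taylor (is_derive_gauss v) d1E cd2.
congr littleo_sqr; apply/funext => t; congr (_%:C%C).
by rewrite /d1 /d2 gauss0; field.
Qed.

End SecondOrderTaylor.
(** * Fourier coefficients on the circle *)

Section CircleMean.
Variable R : realType.
Implicit Types (a b c t : R) (f g : R -> R).

Notation mu := (@lebesgue_measure R).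

Lemma continuous_itv_integrable a b f : continuous f ->
  mu.-integrable `[a, b] (EFin \o f).
Proof.
move=> cf; apply: continuous_compact_integrable; first exact: segment_compact.
exact: continuous_subspaceT.
Qed.

Lemma is_derive_oo_LRcontinuous a b f (df : R -> R) :
  (forall t, is_derive t 1 f (df t)) -> derivable_oo_LRcontinuous f a b.
Proof.
move=> fd; have cf := is_derive_continuous fd; split=> [t _||].
- by case: (fd t).
- exact/cvg_at_right_filter/cf.
- exact/cvg_at_left_filter/cf.
Qed.

Definition circ_mean f : R := (2 * pi)^-1 * \int[mu]_(t in `[- pi, pi]) f t.

Lemma eq_circ_mean f g : f =1 g -> circ_mean f = circ_mean g.
Proof. by move=> /funext ->. Qed.

Lemma circ_meanD f g : continuous f -> continuous g ->
  circ_mean (fun t => f t + g t) = circ_mean f + circ_mean g.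
Proof.
move=> cf cg; rewrite /circ_mean -mulrDr; congr (_ * _).
by apply: RintegralD => //; exact: continuous_itv_integrable.
Qed.

Lemma circ_meanZ c f : continuous f -> circ_mean (fun t => c * f t) = c * circ_mean f.
Proof.
move=> cf; rewrite /circ_mean mulrCA; congr (_ * _).
by apply: RintegralZl => //; exact: continuous_itv_integrable.
Qed.

Lemma circ_mean_cst c : circ_mean (cst c) = c.
Proof.
have pi0 := pi_gt0 R.
have lepi : (- pi < pi :> R)%R by lra.
rewrite /circ_mean Rintegral_cst //.
rewrite /= lebesgue_measure_itv /= lte_fin lepi -EFinB /=.
by move: pi pi0 => p p0; field; exact: lt0r_neq0.
Qed.

Lemma circ_mean_sum (I : Type) (s : seq I) (F : I -> R -> R) :
  (forall i, continuous (F i)) ->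
  circ_mean (fun t => \sum_(i <- s) F i t) = \sum_(i <- s) circ_mean (F i).
Proof.
move=> cF; elim: s => [|i s IH].
  rewrite big_nil -[RHS](circ_mean_cst 0).
  by apply: eq_circ_mean => t; rewrite big_nil.
rewrite big_cons -IH -circ_meanD //; last first.
  by apply: continuous_big => //; exact: add_continuous.
by apply: eq_circ_mean => t; rewrite big_cons.
Qed.

Lemma circ_mean_derive f (df : R -> R) : (forall t, is_derive t 1 f (df t)) ->
  continuous df -> f pi = f (- pi) -> circ_mean df = 0.
Proof.
move=> fd cdf fpi; have lepi : - pi < pi :> R by have := pi_gt0 R; lra.
rewrite /circ_mean /Rintegral (@continuous_FTC2 _ _ f) //.
- by rewrite /= fpi subrr mulr0.
- exact: continuous_subspaceT.
- exact: is_derive_oo_LRcontinuous fd.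
- by move=> t _; rewrite derive1E; apply: derive_val.
Qed.

(* When [sin (b * pi) = 0], [expsin a b] vanishes at [- pi] and [pi], so the mean
   of its derivative is zero. *)
Lemma circ_mean_expcosS a b : sin (b * pi) = 0 ->
  a * circ_mean (expcos a (b + 1)) = - b * circ_mean (expcos a b).
Proof.
move=> sb; have cc x : continuous (expcos a x) by exact: continuous_expcos.
have cZ c x : continuous (fun t => c * expcos a x t).
  by move=> t; apply: cvgM; [exact: cvg_cst|exact: cc].
apply/eqP; rewrite mulNr -addr_eq0 -!circ_meanZ // -circ_meanD //; apply/eqP.
apply: (circ_mean_derive (is_derive_expsin a b)).
  by move=> t; apply: cvgD; exact: cZ.
by rewrite /expsin cosN sinN sinpi oppr0 mulr0 !add0r mulrN sinN sb oppr0.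
Qed.

Lemma circ_mean_expcos1 a : circ_mean (expcos a 1) = 0.
Proof.
have [->|a0] := eqVneq a 0.
  have := @circ_mean_expcosS 0 1; rewrite mul1r sinpi mul0r => /(_ erefl)/esym/eqP.
  by rewrite mulN1r oppr_eq0 => /eqP.
have := @circ_mean_expcosS a 0; rewrite mul0r sin0 oppr0 mul0r add0r => /(_ erefl)/eqP.
by rewrite mulf_eq0 (negbTE a0) => /eqP.
Qed.

Lemma is_derive_circ_mean_expcos a b :
  is_derive a 1 (fun x => circ_mean (expcos x b)) (circ_mean (expcos a (b + 1))).
Proof.
pose f x t := expcos x b t; pose U := `](a - 1), (a + 1)[%classic.
have Ua : U a by rewrite /U /= in_itv /=; lra.
have f'E x t : partial1of2 f x t = expcos x (b + 1) t.
  rewrite partial1of2E; apply: derive_val; exact: is_derive_expcos_amplitude.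
have fint x : U x -> mu.-integrable `[- pi, pi] (EFin \o f x).
  by move=> _; apply: continuous_itv_integrable; exact: continuous_expcos.
have fd x t : U x -> `[- pi, pi]%classic t -> derivable (f ^~ t) x 1.
  by move=> _ _; case: (is_derive_expcos_amplitude x b t).
pose M (_ : R) := expR (`|a| + 1).
have M0 t : 0 <= M t by exact: expR_ge0.
have Mint : mu.-integrable `[- pi, pi] (EFin \o M).
  by apply: continuous_itv_integrable => t; exact: cvg_cst.
have f'M x t : U x -> `[- pi, pi]%classic t -> `|partial1of2 f x t| <= M t.
  rewrite /U /= in_itv /= => /andP[ax xa] _; rewrite f'E.
  rewrite (le_trans (norm_expcos_le _ _ _)) // ler_expR -lerBlDl.
  by rewrite (le_trans (lerB_dist _ _)) // ler_norml; lra.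
have mpi : measurable (`[- pi, pi]%classic : set R) by [].
have dI : is_derive a 1 (fun x => \int[mu]_(t in `[- pi, pi]) f x t)
    (\int[mu]_(t in `[- pi, pi]) expcos a (b + 1) t).
  split; first exact: (@derivable_under_integral R _ _ mu f _ mpi a _ _
    Ua fint fd M M0 Mint f'M).
  rewrite -derive1E (@differentiation_under_integral R _ _ mu f _ mpi a _ _
    Ua fint fd M M0 Mint f'M).
  by apply: eq_Rintegral => t _; rewrite f'E.
by rewrite /circ_mean; apply: is_derive_eq.
Qed.

Lemma circ_mean_expcos0 a : circ_mean (expcos a 0) = 1.
Proof.
transitivity (circ_mean (expcos 0 0)).
  apply: (is_derive_0_is_cst (f := fun x => circ_mean (expcos x 0))) => x.
  by have := is_derive_circ_mean_expcos x 0; rewrite add0r circ_mean_expcos1.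
rewrite -[RHS](circ_mean_cst 1); apply: eq_circ_mean => t.
by rewrite /expcos !mul0r addr0 cos0 expR0 mulr1.
Qed.

Lemma sin_natpi (m : nat) : sin (m%:R * pi) = 0 :> R.
Proof.
elim: m => [|m IH]; first by rewrite mul0r sin0.
by rewrite -nat1r mulrDl mul1r addrC sinDpi IH oppr0.
Qed.

Lemma circ_mean_expcosN a (m : nat) :
  circ_mean (expcos a (- m%:R)) = a ^+ m / m`!%:R.
Proof.
elim: m => [|m IH]; first by rewrite oppr0 circ_mean_expcos0 expr0 fact0 divr1.
have := @circ_mean_expcosS a (- m.+1%:R).
rewrite mulNr sinN sin_natpi oppr0 opprK => /(_ erefl).
rewrite (_ : - m.+1%:R + 1 = - m%:R); last by rewrite -natr1; ring.
have m0 : m.+1%:R != 0 :> R by rewrite pnatr_eq0.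
rewrite IH => e; apply: (mulfI m0); rewrite -e exprS factS natrM invfM.
by rewrite mulrA [RHS]mulrCA mulVKf // mulrA.
Qed.

Lemma Rintegral_itv_scale f a b q : a <= b -> 0 < q -> continuous f ->
  q * \int[mu]_(t in `[a, b]) f t = \int[mu]_(t in `[a * q, b * q]) f (t / q).
Proof.
move=> ab q0 cf; pose F := (fun u : R => u / q).
have dF (u : R) : is_derive u 1 F q^-1.
  by rewrite /F; apply: is_derive_eq; rewrite scaler0 add0r /GRing.scale /= mulr1.
have F'E : F^`()%classic = cst q^-1.
  by apply/funext => u; rewrite derive1E; apply: derive_val.
have qN0 : q != 0 by rewrite gt_eqF.
have cfF : continuous (f \o F).
  by move=> u; apply: continuous_comp; [exact: is_derive_continuous dF _|exact: cf].
have subst : (\int[mu]_(x in `[F (a * q)%R, F (b * q)%R]) (f x)%:E =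
  \int[mu]_(x in `[(a * q)%R, (b * q)%R]) (((f \o F) * F^`()%classic)%R x)%:E)%E.
  apply: integration_by_substitution_increasing.
  - by rewrite ler_pM2r.
  - by move=> x y _ _ xy; rewrite /F ltr_pM2r ?invr_gt0.
  - by rewrite F'E => x _; exact: cvg_cst.
  - by rewrite F'E; exact: is_cvg_cst.
  - by rewrite F'E; exact: is_cvg_cst.
  - exact: is_derive_oo_LRcontinuous dF.
  - exact: continuous_subspaceT.
have -> : \int[mu]_(t in `[a, b]) f t =
    \int[mu]_(x in `[a * q, b * q]) (q^-1 * f (x / q)).
  rewrite /Rintegral; move: subst; rewrite /F !mulfK // => ->.
  by congr fine; apply: eq_integral => x _; rewrite F'E /= [in RHS]mulrC.
by rewrite RintegralZl ?mulVKf //; exact: continuous_itv_integrable cfF.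
Qed.

End CircleMean.

(** * A local limit theorem *)

Section GaussianIntegral.
Variables (R : realType) (v : R).
Hypothesis v_gt0 : 0 < v.
Notation mu := (@lebesgue_measure R).

Let sd : R := (Num.sqrt v)^-1.

Let sd_neq0 : sd != 0. Proof. by rewrite invr_neq0 // gt_eqF // sqrtr_gt0. Qed.

Let sqr_sd : sd ^+ 2 = v^-1. Proof. by rewrite exprVn sqr_sqrtr // ltW. Qed.

Let gaussE t : gauss v t = (normal_peak sd)^-1 * normal_pdf 0 sd t.
Proof.
rewrite normal_pdfE // mulKf ?gt_eqF ?normal_peak_gt0 //.
rewrite /normal_fun subr0 sqr_sd; congr expR; field.
by rewrite gt_eqF.
Qed.

Lemma integrable_gauss : mu.-integrable setT (EFin \o gauss v).
Proof.
have -> : gauss v = (fun t => (normal_peak sd)^-1 * normal_pdf 0 sd t).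
  exact/funext.
by apply: (integrableZl _ _ (integrable_normal_pdf 0 sd)).
Qed.

Lemma Rintegral_gauss : \int[mu]_t gauss v t = Num.sqrt (2 * pi / v).
Proof.
under eq_Rintegral do rewrite gaussE.
rewrite RintegralZl //; last exact: integrable_normal_pdf.
rewrite /Rintegral integral_normal_pdf //= mulr1 invrK sqr_sd.
by rewrite mulrC -mulr_natl mulrA.
Qed.

End GaussianIntegral.

Lemma cvg_dominated_Rintegral d (T : measurableType d) (R : realType)
    (mu : {measure set T -> \bar R}) (f_ : nat -> T -> R) (f g : T -> R) :
  (forall k, measurable_fun setT (f_ k)) -> (forall x, f_ ^~ x @ \oo --> f x) ->
  (forall k x, `|f_ k x| <= g x) -> mu.-integrable setT (EFin \o g) ->
  \int[mu]_x f_ k x @[k --> \oo] --> \int[mu]_x f x.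
Proof.
move=> mf_ f_f f_g intg.
have mEf_ k : measurable_fun setT (EFin \o f_ k) by exact/measurable_EFinP.
have Ef_f x : (EFin \o f_ k) x @[k --> \oo] --> (EFin \o f) x.
  by apply: cvg_EFin; [apply: nearW|exact: f_f].
have mEf : measurable_fun setT (EFin \o f).
  by apply: emeasurable_fun_cvg mEf_ _ => x _; exact: Ef_f.
have [||intf _ cvgf] := @dominated_convergence _ _ _ mu setT measurableT
  (fun k => EFin \o f_ k) (EFin \o f) (EFin \o g) mEf_ mEf _ intg.
- by apply: aeW => x _; exact: Ef_f.
- by apply: aeW => x k _ /=; rewrite lee_fin.
by apply: fine_cvg; rewrite fineK //; exact: integrable_fin_num intf.
Qed.

Section LocalLimit.
Variables (R : realType) (Phi G : R -> R[i]) (v c : R).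
Notation mu := (@lebesgue_measure R).

Hypotheses (Phi_continuous : ccontinuous Phi) (G_continuous : ccontinuous G).
Hypotheses (v_gt0 : 0 < v) (c_gt0 : 0 < c).
Hypothesis Phi_le_gauss : forall t, `|t| <= pi -> normc (Phi t) <= gauss c t.
Hypothesis Phi_taylor : littleo_sqr (fun t => Phi t - (1 - v / 2 * t ^+ 2)%:C%C).
Hypothesis G_le1 : forall t, normc (G t) <= 1.
Hypothesis G0 : G 0 = 1.

Let phi k t := Re (Phi t ^+ k.+1 * G t).

Let rescale k (u : R) := u / Num.sqrt k.+1%:R.

Let window k : set R := `[- pi * Num.sqrt k.+1%:R, pi * Num.sqrt k.+1%:R].

Let sqrtS_gt0 k : 0 < Num.sqrt k.+1%:R :> R. Proof. by rewrite sqrtr_gt0. Qed.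

Let phi_continuous k : continuous (phi k).
Proof. by have [] := ccontinuousM (ccontinuousX k.+1 Phi_continuous) G_continuous. Qed.

Let windowE k u : window k u = (`|rescale k u| <= pi) :> Prop.
Proof.
rewrite /window /= in_itv /= mulNr -ler_norml normf_div.
by rewrite (gtr0_norm (sqrtS_gt0 k)) ler_pdivrMr.
Qed.

Let phi_le_gauss k u : window k u -> `|phi k (rescale k u)| <= gauss c u.
Proof.
rewrite windowE => upi; rewrite -(gauss_div_sqrtX c u k) (le_trans (ler_normc_Re _)) //.
rewrite normcM normcX -[leRHS]mulr1 ler_pM ?exprn_ge0 ?normc_ge0 //.
by rewrite lerXn2r ?nnegrE ?normc_ge0 ?gauss_ge0 // Phi_le_gauss.
Qed.

Let cvg_rescale u : rescale k u @[k --> \oo] --> (0 : R).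
Proof.
rewrite -[X in _ --> X](mulr0 u); apply: cvgM; first exact: cvg_cst.
have -> : (fun k => (Num.sqrt k.+1%:R)^-1) =
    (fun k => Num.sqrt (harmonic k)) :> (nat -> R).
  by apply/funext => k; rewrite sqrtrV.
rewrite -[X in _ --> X](@sqrtr0 R).
by apply: continuous_cvg; [exact: sqrt_continuous|exact: cvg_harmonic].
Qed.

Let near_window u : \forall k \near \oo, window k u.
Proof.
near do rewrite windowE; have /cvgr0_norm_le := cvg_rescale u.
by apply; exact: pi_gt0.
Unshelve. all: by end_near. Qed.

Let phi_sub_gauss_le k u : window k u -> `|phi k (rescale k u) - gauss v u| <=
  k.+1%:R * normc (Phi (rescale k u) - (gauss v (rescale k u))%:C%C) +
  normc (G (rescale k u) - 1).
Proof.
rewrite windowE -(gauss_div_sqrtX v u k) -/(rescale k u) /phi.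
move: (rescale k u) => t tpi.
set w := (gauss v t)%:C%C.
have w_le1 : normc w <= 1 by rewrite normc_real ger0_norm ?gauss_ge0 // gauss_le1 ?ltW.
have Phi_le1 : normc (Phi t) <= 1.
  by rewrite (le_trans (Phi_le_gauss tpi)) // gauss_le1 // ltW.
have -> : Re (Phi t ^+ k.+1 * G t) - gauss v t ^+ k.+1 =
    Re ((Phi t ^+ k.+1 - w ^+ k.+1) * G t + w ^+ k.+1 * (G t - 1)).
  rewrite (_ : _ + _ = Phi t ^+ k.+1 * G t - w ^+ k.+1); last by ring.
  by rewrite -rmorphXn; case: (_ * _).
rewrite (le_trans (ler_normc_Re _)) // (le_trans (le_normcD _ _)) // !normcM lerD //.
  by rewrite (le_trans _ (normc_exprB_le _ Phi_le1 w_le1)) // ler_piMr ?normc_ge0.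
by rewrite ler_piMl ?normc_ge0 // normcX exprn_ile1 ?normc_ge0.
Qed.

Let Phi_gauss : littleo_sqr (fun t => Phi t - (gauss v t)%:C%C).
Proof.
have := littleo_sqrD Phi_taylor (littleo_sqrZ (-1) (littleo_sqr_gauss v)).
by congr littleo_sqr; apply/funext => t; rewrite !rmorphB; ring.
Qed.

Let cvg_phi u : phi k (rescale k u) @[k --> \oo] --> gauss v u.
Proof.
apply/cvgrPdist_le => e e0; pose e' := e / 2 / (u ^+ 2 + 1).
have u1 : 0 < u ^+ 2 + 1 by rewrite ltr_wpDl ?sqr_ge0.
have e'0 : 0 < e' by rewrite !divr_gt0.
have G1 : normc (G t - 1) @[t --> 0] --> (0 : R).
  have cG1 : continuous (fun t => normc (G t - 1)).
    by apply/continuous_normc/ccontinuousD => //; exact: ccontinuous_cst.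
  by have := cG1 0; rewrite /continuous_at G0 subrr normc0.
near=> k; rewrite distrC.
have /phi_sub_gauss_le/le_trans -> // : window k u by near: k; exact: near_window.
rewrite (splitr e) lerD //.
  have Phi_e' : normc (Phi (rescale k u) - (gauss v (rescale k u))%:C%C) <=
      e' * rescale k u ^+ 2.
    by near: k; exact: cvg_rescale (Phi_gauss e'0).
  rewrite (le_trans (ler_wpM2l _ Phi_e')) //.
  rewrite /rescale exprMn exprVn sqr_sqrtr // mulrCA [_%:R * _]mulrC mulfVK //.
  by rewrite /e' mulrAC ler_pdivrMr // ler_wpM2l ?lerDl // ltW // divr_gt0.
rewrite (le_trans (ler_norm _)) //; near: k.
by apply: cvgr0_norm_le (cvg_comp _ _ (cvg_rescale u) G1) _ _; rewrite divr_gt0.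
Unshelve. all: by end_near. Qed.

Theorem local_limit :
  Num.sqrt k%:R * circ_mean (fun t => Re (Phi t ^+ k * G t)) @[k --> \oo]
  --> (Num.sqrt (2 * pi * v))^-1.
Proof.
rewrite -cvg_shiftS.
have -> : (fun k => Num.sqrt k.+1%:R * circ_mean (phi k)) = (fun k =>
    (2 * pi)^-1 * \int[mu]_u ((fun u => phi k (rescale k u)) \_ (window k)) u).
  apply/funext => k; rewrite /circ_mean mulrCA Rintegral_itv_scale //.
    by rewrite Rintegral_mkcond.
  by have := pi_gt0 R; lra.
have -> : (Num.sqrt (2 * pi * v))^-1 = (2 * pi)^-1 * \int[mu]_u gauss v u.
  have pi2_gt0 : 0 < 2 * pi :> R by rewrite mulr_gt0 ?pi_gt0.
  have sN x : 0 < x -> Num.sqrt x != 0 :> R by move=> x0; rewrite gt_eqF // sqrtr_gt0.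
  rewrite Rintegral_gauss // !(sqrtrM _ (ltW pi2_gt0)) sqrtrV ?ltW //.
  rewrite -[X in _ = X^-1 * _](sqr_sqrtr (ltW pi2_gt0)).
  by field; rewrite !sN.
apply: cvgM; first exact: cvg_cst.
apply: (@cvg_dominated_Rintegral _ _ _ mu _ _ (gauss c)); last exact: integrable_gauss.
- move=> k; apply/(measurable_restrictT _ _).1; first exact: measurable_itv.
  apply: measurable_funTS; apply: continuous_measurable_fun => u.
  apply: continuous_comp; last exact: phi_continuous.
  by apply: cvgM; [exact: cvg_id|exact: cvg_cst].
- move=> u; apply: cvg_trans (cvg_phi (u := u)); apply: near_eq_cvg.
  by near=> k; rewrite patchE mem_set //; near: k; exact: near_window.
- move=> k u; rewrite patchE; case: ifPn => [/set_mem|_]; first exact: phi_le_gauss.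
  by rewrite normr0 gauss_ge0.
Unshelve. all: by end_near. Qed.

End LocalLimit.

(** * The Poisson law and the zero-truncated Poisson law *)

Section TrigonometricBounds.
Variable R : realType.
Implicit Types (r t x y : R).

Lemma norm_sin_le x : `|sin x| <= `|x|.
Proof.
have [c _] := MVT_between 0 x (fun t => is_derive_sin t).
by rewrite sin0 !subr0 => ->; rewrite normrM ler_piMl ?cos_max.
Qed.

Lemma mulr_cos_le_sin x : 0 <= x <= pi -> x * cos x <= sin x.
Proof.
move=> /andP[x0 xpi]; have [c] := MVT_between 0 x (fun t => is_derive_sin t).
rewrite (min_idPl x0) (max_idPr x0) sin0 !subr0 => /andP[c0 cx] ->.
rewrite mulrC ler_wpM2r //.
move: cx; rewrite le_eqVlt => /predU1P[-> //|cx].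
by rewrite ltW // ltr_cos // in_itv /=; apply/andP; split => //; lra.
Qed.

Lemma half_le_sin x : 0 <= x <= pi / 2 -> x / 2 <= sin x.
Proof.
move=> /andP[x0 x_le]; have pi0 := pi_gt0 R.
have -> : x = (x / 2) *+ 2 by rewrite -mulr_natr divfK // pnatr_eq0.
have : 0 <= x / 2 <= pi / 4 by lra.
move: (x / 2) => {x x0 x_le} x /andP[x0 x_le].
have sinx : x * cos x <= sin x by apply: mulr_cos_le_sin; lra.
have cosx : 0 <= cos x by apply: cos_ge0_pihalf; lra.
have cosx2 : 0 <= cos (x *+ 2) by apply: cos_ge0_pihalf; rewrite (mulr2n x); lra.
move: cosx2; rewrite cos_mulr2n sin_mulr2n => cosx2.
have := ler_wpM2l cosx sinx; have := mulr_ge0 x0 cosx2.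
by lra.
Qed.

Lemma one_sub_cos_ge t : `|t| <= pi -> t ^+ 2 / 8 <= 1 - cos t.
Proof.
move=> tpi; have t0 := normr_ge0 t.
have sint2 : `|t| / 2 / 2 <= sin (`|t| / 2) by apply: half_le_sin; lra.
have -> : cos t = 1 - 2 * sin (`|t| / 2) ^+ 2.
  rewrite -cos_norm {1}(_ : `|t| = (`|t| / 2) *+ 2).
    by rewrite cos_mulr2n cos2sin2 mulr2n; ring.
  by rewrite -mulr_natr divfK // pnatr_eq0.
rewrite -real_normK ?num_real // subKr.
have : (`|t| / 2 / 2) ^+ 2 <= sin (`|t| / 2) ^+ 2.
  by rewrite lerXn2r // nnegrE ?(le_trans _ sint2) // !divr_ge0.
by lra.
Qed.

Definition sinh x := (expR x - expR (- x)) / 2.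

Lemma ge0_le_sinh x : 0 <= x -> x <= sinh x.
Proof.
move=> x0; pose h t := sinh t - t.
have dh t : is_derive t 1 h ((expR t + expR (- t)) / 2 - 1).
  by rewrite /h /sinh; apply: is_derive_eq; rewrite /GRing.scale /=; field.
have [c _] := MVT_between 0 x dh.
have sinh0 : sinh 0 = 0 by rewrite /sinh oppr0 subrr mul0r.
rewrite /h sinh0 !subr0 => e.
rewrite -subr_ge0 e mulr_ge0 //.
by have := expR_ge1Dx c; have := expR_ge1Dx (- c); lra.
Qed.

Lemma sqr_sinh_sub_le x r : `|x| <= r -> sinh x ^+ 2 - x ^+ 2 <= sinh r ^+ 2 - r ^+ 2.
Proof.
have -> : sinh x ^+ 2 - x ^+ 2 = sinh `|x| ^+ 2 - `|x| ^+ 2.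
  by have [//|_] := ger0P x; rewrite /sinh opprK; field.
move: (normr_ge0 x); move: `|x| => {}x x0 xr.
pose g t := sinh t ^+ 2 - t ^+ 2.
have dg t : is_derive t 1 g (sinh (t * 2) - t * 2).
  rewrite /g /sinh -mulNr !expRM_natr; apply: is_derive_eq; rewrite /GRing.scale /=.
  by field.
have [c] := MVT_between x r dg.
rewrite (min_idPl xr) (max_idPr xr) => /andP[xc _] e.
by rewrite -subr_ge0 e mulr_ge0 ?subr_ge0 // ge0_le_sinh; lra.
Qed.

Lemma sqr_sinh_sin_le x y r : 0 <= r -> x ^+ 2 + y ^+ 2 = r ^+ 2 ->
  sinh x ^+ 2 + sin y ^+ 2 <= sinh r ^+ 2.
Proof.
move=> r0 xyr; have xr : `|x| <= r.
  rewrite -(ler_pXn2r (n := 2)) // ?nnegrE // real_normK ?num_real //.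
  by rewrite -xyr lerDl sqr_ge0.
have := sqr_sinh_sub_le xr; have : sin y ^+ 2 <= y ^+ 2.
  rewrite -(real_normK (num_real (sin y))) -(real_normK (num_real y)).
  by rewrite lerXn2r ?norm_sin_le // nnegrE.
by rewrite -xyr; lra.
Qed.

Lemma sqr_normc_cexpB1 a t : normc (cexp a 0 t - 1) ^+ 2 =
  4 * expR (a * cos t) * (sinh (a / 2 * cos t) ^+ 2 + sin (a / 2 * sin t) ^+ 2).
Proof.
have -> : a * cos t = (a / 2 * cos t) * 2 by field.
rewrite expRM_natr /sinh expRN.
rewrite /cexp /expcos /expsin /= sqr_sqrtr ?addr_ge0 ?sqr_ge0 //.
rewrite mul0r !addr0 oppr0 addr0.
have -> : a * cos t = (a / 2 * cos t) * 2 by field.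
have -> : a * sin t = (a / 2 * sin t) *+ 2 by rewrite mulr2n; field.
move: (a / 2 * cos t) (a / 2 * sin t) => x y.
have expx : expR x != 0 by rewrite gt_eqF ?expR_gt0.
rewrite expRM_natr cos_mulr2n sin_mulr2n.
move: (expR x) expx => p p0.
rewrite (_ : (p ^+ 2 * (cos y * sin y *+ 2)) ^+ 2 =
  4 * p ^+ 4 * cos y ^+ 2 * sin y ^+ 2); last by ring.
by rewrite !(cos2sin2 y); field.
Qed.

(* [|e^z - 1| = 2 |e^(z/2)| |sinh (z/2)| <= 2 e^(Re z / 2) sinh (|z| / 2)] for
   [z = r e^(it)]. *)
Lemma normc_cexpB1_le r t : 0 <= r ->
  normc (cexp r 0 t - 1) <= (expR r - 1) * expR (- (r / 2 * (1 - cos t))).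
Proof.
move=> r0; rewrite -(ler_pXn2r (n := 2)) // ?nnegrE ?normc_ge0 //; last first.
  by rewrite mulr_ge0 ?expR_ge0 // subr_ge0 -expR0 ler_expR.
have -> : ((expR r - 1) * expR (- (r / 2 * (1 - cos t)))) ^+ 2 =
    4 * expR (r * cos t) * sinh (r / 2) ^+ 2.
  have -> : - (r / 2 * (1 - cos t)) = r / 2 * cos t - r / 2 by ring.
  have -> : r * cos t = (r / 2 * cos t) * 2 by field.
  rewrite {1}(_ : r = r / 2 * 2); last by field.
  rewrite !expRM_natr /sinh expRB !expRN; field.
  by rewrite gt_eqF ?expR_gt0.
rewrite sqr_normc_cexpB1 ler_wpM2l ?mulr_ge0 ?expR_ge0 // sqr_sinh_sin_le ?divr_ge0 //.
by rewrite !exprMn -mulrDr cos2Dsin2 mulr1.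
Qed.

End TrigonometricBounds.

(* The rescaled mass at its mean [n] of the Poisson law of parameter [n]; its
   limit is Stirling's formula. *)
Definition poisson_peak (R : realType) (n : nat) : R :=
  Num.sqrt n%:R * (expR (- n%:R) * n%:R ^+ n / n`!%:R).

Lemma cvg_poisson_peak (R : realType) :
  poisson_peak R n @[n --> \oo] --> (Num.sqrt (2 * pi))^-1.
Proof.
pose Phi t : R[i] := (expR (-1))%:C%C * cexp 1 (-1) t.
have Phi_continuous : ccontinuous Phi.
  by apply: ccontinuousM; [exact: ccontinuous_cst|exact: ccontinuous_cexp].
have Phi_le t : `|t| <= pi -> normc (Phi t) <= gauss 4^-1 t.
  move=> tpi; rewrite normcM normc_cexp normc_real ger0_norm ?expR_ge0 //.
  by rewrite -expRD ler_expR; have := one_sub_cos_ge tpi; lra.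
have Phi_taylor : littleo_sqr (fun t => Phi t - (1 - 1 / 2 * t ^+ 2)%:C%C).
  have := littleo_sqrZ (expR (-1))%:C%C (@littleo_sqr_cexp R 1 (-1)).
  congr littleo_sqr; apply/funext => t.
  rewrite mulrBr mulrA -rmorphM -expRD addNr expR0 rmorph1 mul1r /Phi.
  by congr (_ - _); rewrite addrN expr0n /= mul0r add0r.
have peakE n : poisson_peak R n =
    Num.sqrt n%:R * circ_mean (fun t => Re (Phi t ^+ n * 1)).
  congr (_ * _).
  rewrite -mulN1r -mulrA -circ_mean_expcosN expRM_natr -circ_meanZ; last first.
    exact: continuous_expcos.
  apply: eq_circ_mean => t; rewrite mulr1 exprMn -rmorphXn cexpX /= mul0r subr0.
  by rewrite mulr1 mulrN1.
under eq_fun do rewrite peakE.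
have := local_limit Phi_continuous (ccontinuous_cst 1) ltr01 _ Phi_le Phi_taylor.
by rewrite invr_gt0 ltr0n mulr1 normc1; apply.
Qed.

Section ZeroTruncatedPoisson.
Variables (R : realType) (r : R).
Hypothesis r_gt0 : 0 < r.

Definition ztp_mean : R := r * expR r / (expR r - 1).
Definition ztp_var : R := ztp_mean * (1 + r - ztp_mean).

Definition ztp_char t : R[i] := (cexp r 0 t - 1) / (expR r - 1)%:C%C.

(* The probability that [k] independent variables with characteristic function
   [ztp_char] sum up to [m]. *)
Definition ztp_sum_mass (k m : nat) : R :=
  r ^+ m / m`!%:R * (num_surj m k)%:R / (expR r - 1) ^+ k.

Let expB1_gt0 : 0 < expR r - 1. Proof. by rewrite subr_gt0 expR_gt1. Qed.

Let expB1_neq0 : expR r - 1 != 0. Proof. by rewrite gt_eqF. Qed.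

Lemma ztp_mean_gt0 : 0 < ztp_mean.
Proof. by rewrite divr_gt0 // mulr_gt0 // expR_gt0. Qed.

Lemma ztp_var_gt0 : 0 < ztp_var.
Proof.
rewrite mulr_gt0 ?ztp_mean_gt0 // subr_gt0 ltr_pdivrMr //.
have : 1 + r < expR r by apply: expR_gt1Dx; rewrite gt_eqF.
by rewrite mulrDl mul1r mulrBr; lra.
Qed.

Lemma ztp_meanE : ztp_mean = r / (1 - expR (- r)).
Proof.
rewrite /ztp_mean expRN; have expr_neq0 : expR r != 0 by rewrite gt_eqF ?expR_gt0.
by field; rewrite expr_neq0 expB1_neq0.
Qed.

Lemma normc_ztp_char_le t : `|t| <= pi -> normc (ztp_char t) <= gauss (r / 8) t.
Proof.
move=> tpi; rewrite normcM normcV normc_real gtr0_norm // ler_pdivrMr // mulrC.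
rewrite (le_trans (normc_cexpB1_le t (ltW r_gt0))) // ler_wpM2l ?(ltW expB1_gt0) //.
rewrite ler_expR lerN2.
have := ler_wpM2l (ltW r_gt0) (one_sub_cos_ge tpi); lra.
Qed.

Lemma circ_mean_ztp_char k m :
  circ_mean (fun t => Re (ztp_char t ^+ k * cexp 0 (- m%:R) t)) = ztp_sum_mass k m.
Proof.
have expand t : Re (ztp_char t ^+ k * cexp 0 (- m%:R) t) = (expR r - 1) ^- k *
    \sum_(A : {set 'I_k}) (-1) ^+ #|~: A| * expcos (#|A|%:R * r) (- m%:R) t.
  have := @exprB1_subsets R[i] 'I_k (cexp r 0 t); rewrite card_ord => expX.
  rewrite /ztp_char expr_div_n expX -rmorphXn -fmorphV mulrAC mulr_suml mulrC.
  have Re_real (x : R) z : Re (x%:C%C * z) = x * Re z.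
    by case: z => a b /=; rewrite mul0r subr0.
  rewrite Re_real (raddf_sum (@complex.Re R : Rcomplex R -> R)); congr (_ * _).
  apply: eq_bigr => A _; rewrite -mulrA cexpX mulr0 cexpM add0r addr0.
  by rewrite -(rmorphN1 (real_complex R)) -rmorphXn; exact: Re_real.
rewrite (eq_circ_mean expand) circ_meanZ; last first.
  apply: continuous_big => [|A _]; first exact: add_continuous.
  by move=> t; apply: cvgM; [exact: cvg_cst|exact: continuous_expcos].
rewrite circ_mean_sum => [|A t]; last first.
  by apply: cvgM; [exact: cvg_cst|exact: continuous_expcos].
rewrite mulrC /ztp_sum_mass num_surj_subsets; congr (_ * _).
rewrite mulr_sumr; apply: eq_bigr => A _.
by rewrite circ_meanZ ?circ_mean_expcosN ?exprMn; [ring|exact: continuous_expcos].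
Qed.

Lemma littleo_sqr_ztp_char : littleo_sqr (fun t =>
  ztp_char t * cexp 0 (- ztp_mean) t - (1 - ztp_var / 2 * t ^+ 2)%:C%C).
Proof.
pose taylor a b t : R[i] := (expR a)%:C%C *
  ((1 - ((a + b) ^+ 2 + a) / 2 * t ^+ 2) +i* ((a + b) * t))%C.
pose c : R[i] := ((expR r - 1)^-1)%:C%C.
have charE t : ztp_char t * cexp 0 (- ztp_mean) t =
    c * (cexp r (- ztp_mean) t - cexp 0 (- ztp_mean) t).
  by rewrite /ztp_char /c fmorphV mulrAC mulrC mulrBl mul1r cexpM addr0 add0r.
have taylorE t : (1 - ztp_var / 2 * t ^+ 2)%:C%C =
    c * (taylor r (- ztp_mean) t - taylor 0 (- ztp_mean) t).
  apply/eqP; rewrite eq_complex /= expR0 /ztp_var /ztp_mean.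
  by apply/andP; split; apply/eqP; field.
have := littleo_sqrZ c (littleo_sqrD (littleo_sqr_cexp r (- ztp_mean))
  (littleo_sqrZ (-1) (littleo_sqr_cexp 0 (- ztp_mean)))).
by congr littleo_sqr; apply/funext => t; rewrite charE taylorE /taylor; ring.
Qed.

Lemma ztp_local_limit (T : Type) (F : set_system T) {FF : Filter F}
    (k m : T -> nat) (i : nat) : k @ F --> \oo ->
  (\forall x \near F, (k x)%:R * ztp_mean = (m x)%:R + i%:R) ->
  Num.sqrt (k x)%:R * ztp_sum_mass (k x) (m x) @[x --> F]
  --> (Num.sqrt (2 * pi * ztp_var))^-1.
Proof.
move=> koo kF; pose Phi t := ztp_char t * cexp 0 (- ztp_mean) t.
have Phi_continuous : ccontinuous Phi.
  apply: ccontinuousM; last exact: ccontinuous_cexp.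
  apply: ccontinuousM; last exact: ccontinuous_cst.
  by apply: ccontinuousD; [exact: ccontinuous_cexp|exact: ccontinuous_cst].
have normc_cexp0 b (t : R) : normc (cexp 0 b t) = 1 by rewrite normc_cexp mul0r expR0.
have Phi_le t : `|t| <= pi -> normc (Phi t) <= gauss (r / 8) t.
  by move=> tpi; rewrite normcM normc_cexp0 mulr1 normc_ztp_char_le.
have := local_limit Phi_continuous (ccontinuous_cexp 0 i%:R) ztp_var_gt0
  (divr_gt0 r_gt0 _) Phi_le littleo_sqr_ztp_char.
have G_le1 (t : R) : normc (cexp 0 i%:R t) <= 1 by rewrite normc_cexp0.
rewrite ltr0n cexp_at0 expR0 => /(_ isT G_le1 erefl) /(cvg_comp _ _ koo).
apply: cvg_trans; apply: near_eq_cvg; near=> x; congr (_ * _).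
rewrite -circ_mean_ztp_char; apply: eq_circ_mean => t.
rewrite exprMn -mulrA cexpX mulr0 cexpM addr0 mulrN (near kF x) //.
by congr (Re (_ * cexp _ _ _)); ring.
Unshelve. all: by end_near. Qed.

End ZeroTruncatedPoisson.

(** * Asymptotics *)

Section Tannery.
Variables (R : realType) (V : normedModType R) (F : set_system nat).
Context {FF : Filter F}.
Variables (a : nat -> nat -> V) (alpha : nat -> V) (g : nat -> R) (l : V).

Lemma tannery : F --> \oo -> (forall i, a n i @[n --> F] --> alpha i) ->
  (\forall n \near F, forall i, (i <= n)%N -> `|a n i| <= g i) ->
  cvgn (series g) -> series alpha @ \oo --> l ->
  \sum_(i < n.+1) a n i @[n --> F] --> l.
Proof.
move=> F_oo a_alpha a_le g_cvg alpha_l; apply/cvgrPdist_le => e e0.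
have e3 : 0 < e / 3 by rewrite divr_gt0.
have g_tails : \forall N \near \oo,
    forall m, (N <= m)%N -> `|\sum_(N <= i < m) g i| <= e / 3.
  move/cvg_cauchy/cauchy_seriesP/(_ _ e3): g_cvg => [[A B] [[N1 _ N1A] [N2 _ N2B]] AB].
  exists (maxn N1 N2) => // N; rewrite /= geq_max => /andP[N1N N2N] m Nm.
  by apply/ltW/(AB (N, m)); split; [exact: N1A|exact/N2B/(leq_trans N2N)].
near \oo => N.
have g_tail : forall m, (N <= m)%N -> `|\sum_(N <= i < m) g i| <= e / 3 by near: N.
have alphaN : `|l - series alpha N| <= e / 3.
  by near: N; exact: (cvgrPdist_le _ _).1 alpha_l _ e3.
have a_series : \sum_(0 <= i < N) a n i @[n --> F] --> series alpha N.
  by apply: cvg_big => //; exact: add_continuous.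
near=> n; have Nn : (N <= n.+1)%N by near: n; apply: F_oo; exists N => // n /= /leqW.
have a_head : `|series alpha N - \sum_(0 <= i < N) a n i| <= e / 3.
  by near: n; exact: (cvgrPdist_le _ _).1 a_series _ e3.
have a_tail : `|\sum_(N <= i < n.+1) a n i| <= e / 3.
  rewrite (le_trans (ler_norm_sum _ _ _)) // (le_trans _ (g_tail _ Nn)) //.
  rewrite (le_trans _ (ler_norm _)) // big_nat_cond [leRHS]big_nat_cond.
  apply: ler_sum => i /andP[/andP[_ ni] _].
  have : forall i, (i <= n)%N -> `|a n i| <= g i by near: n.
  by apply; rewrite -ltnS.
rewrite -(big_mkord xpredT (a n)) (big_cat_nat (leq0n N) Nn) //=.
rewrite opprD addrA -(subrKA (series alpha N) l).
rewrite (le_trans (ler_normB _ _)) // (le_trans (lerD (ler_normD _ _) (lexx _))) //.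
by lra.
Unshelve. all: by end_near. Qed.

End Tannery.

Section FallingFactorialCoefficients.
Variable R : realType.

Lemma cvg_ffact_ratio i : (n ^_ i)%:R / n%:R ^+ i @[n --> \oo] --> (1 : R).
Proof.
elim: i => [|i IH].
  by under eq_fun do rewrite ffactn0 expr0 divr1; exact: cvg_cst.
have ratioS : 1 - i%:R * n%:R^-1 @[n --> \oo] --> (1 : R).
  rewrite -[X in _ --> X]subr0; apply: cvgB; first exact: cvg_cst.
  rewrite -[X in _ --> X](mulr0 i%:R); apply: cvgM; first exact: cvg_cst.
  apply/gtr0_cvgV0; first by near do rewrite ltr0n; exists 1%N.
  exact: cvgr_idn.
rewrite -[X in _ --> X]mulr1; apply: cvg_trans (cvgM IH ratioS).
apply: near_eq_cvg; near=> n.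
have n0 : n%:R != 0 :> R by rewrite pnatr_eq0 -lt0n; near: n; exists 1%N.
have ni : (i <= n)%N by near: n; exists i.
rewrite /= ffactnSr natrM natrB // exprSr; field.
by rewrite n0 expf_neq0.
Unshelve. all: by end_near. Qed.

Lemma ffact_coef_ratio_le n i : (0 < n)%N ->
  (ffact_coef n i)%:R / n%:R ^+ (2 * i) <= (2 ^+ i * i`!%:R)^-1 :> R.
Proof.
move=> n0; rewrite ler_pdivrMr ?exprn_gt0 ?ltr0n // ler_pdivlMl; last first.
  by rewrite mulr_gt0 ?exprn_gt0 // ltr0n fact_gt0.
by rewrite -!natrX -!natrM ler_nat ffact_coef_le_expn.
Qed.

Lemma cvg_ffact_coef_ratio i :
  (ffact_coef n i)%:R / n%:R ^+ (2 * i) @[n --> \oo] --> ((2 ^+ i * i`!%:R)^-1 : R).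
Proof.
have c0 : 0 < 2 ^+ i * i`!%:R :> R by rewrite mulr_gt0 ?exprn_gt0 // ltr0n fact_gt0.
apply: (@squeeze_cvgr _ _ _ _
  (fun n => (2 ^+ i * i`!%:R)^-1 * ((n ^_ (2 * i))%:R / n%:R ^+ (2 * i)))
  (cst (2 ^+ i * i`!%:R)^-1)); last exact: cvg_cst.
  near=> n; have n0 : (0 < n)%N by near: n; exists 1%N.
  rewrite ffact_coef_ratio_le // andbT mulrA ler_wpM2r ?invr_ge0 ?exprn_ge0 //.
  by rewrite ler_pdivrMl // -natrX -!natrM ler_nat ffact_le_ffact_coef.
rewrite -[X in _ --> X]mulr1; apply: cvgM; first exact: cvg_cst.
exact: cvg_ffact_ratio.
Unshelve. all: by end_near. Qed.

End FallingFactorialCoefficients.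

Definition prescribed_size (R : realType) (x : R) (n k : nat) : Prop :=
  k%:R = n%:R * x * (1 - expR (- (1 / x))).

(* The asymptotic value of the number of surjections from an [n]-set onto a set
   of the prescribed size. *)
Definition surj_asym (R : realType) (x : R) (n : nat) : R :=
  n%:R ^+ n * expR (n%:R * w x) * v x.

Definition surj_ratio (R : realType) (x : R) (k n i : nat) : R :=
  n%:R ^+ i * (num_surj (n - i) k)%:R / surj_asym x n.

Section SurjectionAsymptotics.
Variables (R : realType) (sigma : R).
Hypothesis sigma_gt0 : 0 < sigma.

Let r := 1 / sigma.
Let q := expR (- r).
Let mean := ztp_mean r.

Let r_gt0 : 0 < r. Proof. by rewrite divr_gt0. Qed.

Let r_neq0 : r != 0. Proof. by rewrite gt_eqF. Qed.

Let sigmaE : sigma = r^-1. Proof. by rewrite /r div1r invrK. Qed.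

Let onemq_gt0 : 0 < 1 - q.
Proof. by rewrite subr_gt0 -expR0 ltr_expR oppr_lt0. Qed.

Let onemq_neq0 : 1 - q != 0. Proof. by rewrite gt_eqF. Qed.

Let mean_gt0 : 0 < mean. Proof. exact: ztp_mean_gt0. Qed.

Lemma v_ztp : v sigma = Num.sqrt (mean / ztp_var r).
Proof.
congr Num.sqrt; rewrite -/r -/q /ztp_var -/mean sigmaE.
have := ztp_var_gt0 r_gt0; rewrite /ztp_var -/mean pmulr_rgt0 // => /lt0r_neq0.
rewrite /mean ztp_meanE // -/q => var_neq0.
have d_neq0 : (1 + r) * (1 - q) - r != 0.
  apply: contraNneq var_neq0 => d0.
  by rewrite -(mulfK onemq_neq0 (1 + r)) -mulrBl d0 mul0r.
by field; rewrite onemq_neq0 r_neq0 d_neq0.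
Qed.

Lemma v_gt0 : 0 < v sigma.
Proof. by rewrite v_ztp sqrtr_gt0 divr_gt0 // ztp_var_gt0. Qed.

Lemma expR_w n k : prescribed_size sigma n k ->
  expR (n%:R * w sigma) = (expR r - 1) ^+ k * sigma ^+ n * expR (- n%:R).
Proof.
move=> kE; have -> : expR r - 1 = (1 - q) * expR r.
  by rewrite mulrBl mul1r -expRD addNr expR0.
have -> : n%:R * w sigma =
    k%:R * ln (1 - q) + k%:R * r + n%:R * ln sigma - n%:R.
  rewrite /w kE -/r -/q /r; field.
  by rewrite gt_eqF.
by rewrite !expRD !expRM_natl !lnK ?posrE // exprMn.
Qed.

Lemma prescribed_size_mean n k : prescribed_size sigma n k -> k%:R * mean = n%:R.
Proof.
move=> ->; rewrite -/r /mean ztp_meanE // -/q sigmaE; field.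
by rewrite onemq_neq0.
Qed.

Lemma surj_asym_gt0 n : 0 < surj_asym sigma n.
Proof.
rewrite !mulr_gt0 ?expR_gt0 ?v_gt0 //.
by case: n => [|n]; rewrite ?expr0 // exprn_gt0 ?ltr0n.
Qed.

Lemma surj_ratio_ge0 k n i : 0 <= surj_ratio sigma k n i.
Proof. by apply: divr_ge0; rewrite ?(ltW (surj_asym_gt0 n)) // mulr_ge0 ?exprn_ge0. Qed.

Lemma surj_ratioE k n i : (0 < n)%N -> (i <= n)%N ->
    prescribed_size sigma n k ->
  surj_ratio sigma k n i = (Num.sqrt k%:R * ztp_sum_mass r k (n - i)) /
    poisson_peak R n / ((n ^_ i)%:R / n%:R ^+ i) * (r ^+ i * Num.sqrt mean / v sigma).
Proof.
move=> n0 ni kE; have nR : 0 < n%:R :> R by rewrite ltr0n.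
have k_gt0 : 0 < k%:R :> R by rewrite kE -/r -/q !mulr_gt0.
have sqrtn : Num.sqrt n%:R = Num.sqrt k%:R * Num.sqrt mean.
  by rewrite -sqrtrM ?ltW // (prescribed_size_mean kE).
have sigmaX : sigma ^+ n = (r ^+ (n - i) * r ^+ i)^-1.
  by rewrite -exprD subnK // sigmaE exprVn.
rewrite /surj_ratio /surj_asym (expR_w kE) /ztp_sum_mass /poisson_peak sqrtn sigmaX.
rewrite -(ffact_fact ni) natrM.
have vN : v sigma != 0 by rewrite gt_eqF // v_gt0.
have sqrtkN : Num.sqrt k%:R != 0 :> R by rewrite gt_eqF // sqrtr_gt0.
have sqrtmN : Num.sqrt mean != 0 by rewrite gt_eqF // sqrtr_gt0.
have expB1N : expR r - 1 != 0 by rewrite subr_eq0 gt_eqF // expR_gt1.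
have expnN : expR (- n%:R) != 0 :> R by rewrite gt_eqF // expR_gt0.
have ffactN : (n ^_ i)%:R != 0 :> R by rewrite pnatr_eq0 -lt0n ffact_gt0.
have factN : (n - i)`!%:R != 0 :> R by rewrite pnatr_eq0 -lt0n fact_gt0.
have nN : n%:R != 0 :> R by rewrite gt_eqF.
by field; rewrite vN sqrtkN sqrtmN expnN ffactN factN !expf_neq0.
Qed.

Variables (k : nat -> nat) (F : set_system nat).
Context {FF : Filter F}.
Hypothesis F_oo : F --> \oo.
Hypothesis kF : \forall n \near F, prescribed_size sigma n (k n).

Let k_oo : k @ F --> \oo.
Proof.
apply/cvgnyPge => N; near=> n.
rewrite -(ler_nat R) (near kF n) // -/r -/q -mulrA -ler_pdivrMr ?mulr_gt0 //.
by near: n; apply: F_oo; exact: nbhs_infty_ger.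
Unshelve. all: by end_near. Qed.

Lemma cvg_surj_ratio i : surj_ratio sigma (k n) n i @[n --> F] --> r ^+ i.
Proof.
have var_gt0 := ztp_var_gt0 r_gt0.
have sqrtN (x : R) : 0 < x -> Num.sqrt x != 0 by move=> x0; rewrite gt_eqF // sqrtr_gt0.
have pi2_gt0 : 0 < 2 * pi :> R by rewrite mulr_gt0 ?pi_gt0.
have mass_cvg : Num.sqrt (k n)%:R * ztp_sum_mass r (k n) (n - i) @[n --> F]
    --> (Num.sqrt (2 * pi * ztp_var r))^-1.
  apply: (@ztp_local_limit _ _ r_gt0 _ _ _ _ _ i) => //; near=> n.
  have ni : (i <= n)%N by near: n; apply: F_oo; exact: nbhs_infty_ge.
  by rewrite -natrD subnK // (prescribed_size_mean (near kF n _)).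
have peak_cvg : poisson_peak R n @[n --> F] --> (Num.sqrt (2 * pi))^-1.
  exact: cvg_comp _ _ F_oo (@cvg_poisson_peak R).
have ffact_cvg : (n ^_ i)%:R / n%:R ^+ i @[n --> F] --> (1 : R).
  exact: cvg_comp _ _ F_oo (@cvg_ffact_ratio R i).
have -> : r ^+ i = (Num.sqrt (2 * pi * ztp_var r))^-1 / (Num.sqrt (2 * pi))^-1 / 1 *
    (r ^+ i * Num.sqrt mean / v sigma).
  rewrite v_ztp (sqrtrM _ (ltW pi2_gt0)) (sqrtrM (ztp_var r)^-1 (ltW mean_gt0)).
  rewrite sqrtrV ?ltW //.
  by field; rewrite !sqrtN.
have ratio_cvg : Num.sqrt (k n)%:R * ztp_sum_mass r (k n) (n - i) / poisson_peak R n /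
    ((n ^_ i)%:R / n%:R ^+ i) * (r ^+ i * Num.sqrt mean / v sigma) @[n --> F] -->
    (Num.sqrt (2 * pi * ztp_var r))^-1 / (Num.sqrt (2 * pi))^-1 / 1 *
    (r ^+ i * Num.sqrt mean / v sigma).
  apply: cvgM; last exact: cvg_cst.
  by do 2![apply: cvgM; last by apply: cvgV; rewrite ?invr_neq0 ?sqrtN].
apply: cvg_trans ratio_cvg; apply: near_eq_cvg; near=> n.
rewrite surj_ratioE //; near: n => //.
- by apply: F_oo; exact: nbhs_infty_gt.
- by apply: F_oo; exact: nbhs_infty_ge.
Unshelve. all: by end_near. Qed.

Lemma near_surj_ratio_le : \forall n \near F, forall i, (i <= n)%N ->
  surj_ratio sigma (k n) n i <= 2 * mean ^+ i.
Proof.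
have ratio0_le2 : \forall n \near F, surj_ratio sigma (k n) n 0 <= 2.
  have := @cvg_surj_ratio 0; rewrite expr0 => ratio0_cvg.
  by apply: cvgr_le ratio0_cvg _ _; rewrite ltr1n.
near=> n => i ni; have asym_gt0 := surj_asym_gt0 n.
have kE : prescribed_size sigma n (k n) by near: n.
rewrite /surj_ratio -{1}(prescribed_size_mean kE) [_ * mean]mulrC exprMn -!mulrA mulrC.
rewrite ler_wpM2r ?exprn_ge0 ?(ltW mean_gt0) //.
apply: (@le_trans _ _ (surj_ratio sigma (k n) n 0)); last first.
  by near: n; exact: ratio0_le2.
rewrite /surj_ratio expr0 mul1r subn0 mulrA ler_wpM2r ?invr_ge0 ?(ltW asym_gt0) //.
rewrite -natrX -natrM ler_nat.
by have := expn_num_surj_le i (n - i) (k n); rewrite subnKC.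
Unshelve. all: by end_near. Qed.

End SurjectionAsymptotics.

Section IncidenceSum.
Variables (R : realType) (sigma tau : R).
Hypotheses (sigma_gt0 : 0 < sigma) (tau_gt0 : 0 < tau).

Definition incidence_term (k l n i : nat) : R :=
  (-1) ^+ i * ((ffact_coef n i)%:R / n%:R ^+ (2 * i)) *
  (surj_ratio sigma k n i * surj_ratio tau l n i).

Lemma sum_incidence_term k l n : (0 < n)%N ->
  \sum_(i < n.+1) incidence_term k l n i =
  n`!%:R * (num_incidence k l n)%:R / (surj_asym sigma n * surj_asym tau n).
Proof.
move=> n0; rewrite fact_num_incidence mulr_suml; apply: eq_bigr => i _.
have ni0 : n%:R ^+ i != 0 :> R by rewrite expf_neq0 // pnatr_eq0 -lt0n.
rewrite /incidence_term /surj_ratio mul2n -addnn exprD.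
rewrite (invfM (surj_asym sigma n)).
by move: (surj_asym sigma n)^-1 (surj_asym tau n)^-1 => a b; field.
Qed.

Variables (k l : nat -> nat) (F : set_system nat).
Context {FF : Filter F}.
Hypothesis F_oo : F --> \oo.
Hypothesis kF : \forall n \near F, prescribed_size sigma n (k n).
Hypothesis lF : \forall n \near F, prescribed_size tau n (l n).

Lemma cvg_incidence_term i : incidence_term (k n) (l n) n i @[n --> F] -->
  exp_coeff (- (1 / (2 * sigma * tau))) i.
Proof.
have -> : exp_coeff (- (1 / (2 * sigma * tau))) i =
    (-1) ^+ i * (2 ^+ i * i`!%:R)^-1 * ((1 / sigma) ^+ i * (1 / tau) ^+ i).
  rewrite /exp_coeff /=.
  have -> : - (1 / (2 * sigma * tau)) = -1 * 2^-1 * (1 / sigma) * (1 / tau).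
    by field; rewrite !gt_eqF.
  by rewrite !exprMn exprVn invfM; ring.
rewrite /incidence_term.
apply: cvgM; last by apply: cvgM; exact: cvg_surj_ratio.
apply: cvgM; first exact: cvg_cst.
exact: cvg_comp _ _ F_oo (@cvg_ffact_coef_ratio R i).
Qed.

Lemma near_incidence_term_le : \forall n \near F, forall i, (i <= n)%N ->
  `|incidence_term (k n) (l n) n i| <=
  4 * exp_coeff (ztp_mean (1 / sigma) * ztp_mean (1 / tau) / 2) i.
Proof.
near=> n => i ni.
have n0 : (0 < n)%N by near: n; apply: F_oo; exact: nbhs_infty_gt.
have /(_ i ni) ratio_k : forall j, (j <= n)%N ->
    surj_ratio sigma (k n) n j <= 2 * ztp_mean (1 / sigma) ^+ j.
  by near: n; exact: near_surj_ratio_le.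
have /(_ i ni) ratio_l : forall j, (j <= n)%N ->
    surj_ratio tau (l n) n j <= 2 * ztp_mean (1 / tau) ^+ j.
  by near: n; exact: near_surj_ratio_le.
have ratio_k0 := surj_ratio_ge0 sigma_gt0 (k n) n i.
have ratio_l0 := surj_ratio_ge0 tau_gt0 (l n) n i.
have coef0 : 0 <= (ffact_coef n i)%:R / n%:R ^+ (2 * i) :> R.
  by rewrite divr_ge0 ?exprn_ge0.
rewrite /incidence_term -mulrA normrM normrX normrN1 expr1n [leLHS]mul1r.
rewrite ger0_norm; last by apply: mulr_ge0 => //; apply: mulr_ge0.
have -> : 4 * exp_coeff (ztp_mean (1 / sigma) * ztp_mean (1 / tau) / 2) i =
    (2 ^+ i * i`!%:R)^-1 *
    ((2 * ztp_mean (1 / sigma) ^+ i) * (2 * ztp_mean (1 / tau) ^+ i)).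
  move: (ztp_mean _) (ztp_mean _) => x y.
  by rewrite /exp_coeff /= !exprMn exprVn invfM; ring.
by apply: ler_pM => //; [apply: mulr_ge0|exact: ffact_coef_ratio_le|apply: ler_pM].
Unshelve. all: by end_near. Qed.

Lemma cvg_sum_incidence_term :
  \sum_(i < n.+1) incidence_term (k n) (l n) n i @[n --> F] -->
  expR (- (1 / (2 * sigma * tau))).
Proof.
apply: tannery cvg_incidence_term near_incidence_term_le _ _ => //.
  exact: is_cvg_seriesZ (is_cvg_series_exp_coeff _).
exact: is_cvg_series_exp_coeff.
Qed.

End IncidenceSum.

(* m_kl(n) is only defined for integers k and l, so n tends to infinity
   through those n for which k(n) and l(n) have the prescribed values. *)
Theorem theorem2 (R : realType) (sigma tau : R) (k l : nat -> nat)
    (sigma_gt0 : 0 < sigma) (tau_gt0 : 0 < tau) :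
  (num_incidence (k n) (l n) n)%:R /
    (n%:R ^+ (2 * n) / (n`!)%:R
     * expR (n%:R * w sigma) * v sigma
     * expR (n%:R * w tau) * v tau
     * expR (- (1 / (2 * sigma * tau))))
  @[n --> within [set n : nat |
        (k n)%:R = n%:R * sigma * (1 - expR (- (1 / sigma))) /\
        (l n)%:R = n%:R * tau * (1 - expR (- (1 / tau)))] \oo] --> (1 : R).
Proof.
set F := within _ _; have F_filter : Filter F by exact: within_filter.
have F_oo : F --> \oo by exact: cvg_within.
have kF : \forall n \near F, prescribed_size sigma n (k n).
  by apply: filterS (withinT _ _) => n [].
have lF : \forall n \near F, prescribed_size tau n (l n).
  by apply: filterS (withinT _ _) => n [].
have exp_neq0 : expR (- (1 / (2 * sigma * tau))) != 0 by rewrite gt_eqF ?expR_gt0.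
have sum_cvg : (\sum_(i < n.+1) incidence_term sigma tau (k n) (l n) n i) /
    expR (- (1 / (2 * sigma * tau))) @[n --> F] --> (1 : R).
  rewrite -[X in _ --> X](divff exp_neq0); apply: cvgM; last exact: cvg_cst.
  exact: cvg_sum_incidence_term.
apply: cvg_trans sum_cvg; apply: near_eq_cvg; near=> n.
have n0 : (0 < n)%N by near: n; apply: F_oo; exact: nbhs_infty_gt.
rewrite sum_incidence_term // /surj_asym mul2n -addnn exprD.
rewrite !invfM !invrK; ring.
Unshelve. all: by end_near. Qed.
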